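(* Let $G$ be an almost connected, locally compact Hausdorff topological group, and let $\alpha$ be the canonical action of $G$ on $B^{\infty}(G)$, the closed unit ball of $L^1(G)'$ with the weak-$^{\ast}$ topology, given by $\alpha(g,l)(f) = l(f \circ \lambda_G(g))$. Let $S$ be a compact generating subset of $G$. If $G$ is not compact, then $$\sup\{ \eta(\alpha,S,\mathcal{V}) \mid \mathcal{V} \in \mathcal{C}(B^{\infty}(G)),\ |\mathcal{V}| = 2\} = \infty .$$
   Context: $\mathbb{N}$ is the set of natural numbers excluding $0$. A topological group $G$ is almost connected if the quotient $G/N(G)$ (with the quotient topology) is compact, where $N(G)$ is the connected component of the neutral element $e_G$ in $G$. A subset $S \subseteq G$ generates $G$ if $S$ contains $e_G$ and $G = \bigcup_{n\in\mathbb{N}} S^n$, where $S^n = \{s_1\cdots s_n \mid s_i \in S\}$. Fix $\mathbb{K} \in \{\mathbb{R},\mathbb{C}\}$ and a left Haar measure $\mu$ on $G$; $L^1(G)$ is the Banach space of ($\mathbb{K}$-valued) $\mu$-integrable functions (modulo null functions) with norm $\|\cdot\|_1$, and $L^1(G)'$ is its dual Banach space. $B^{\infty}(G)$ is the closed unit ball of $L^1(G)'$ endowed with the weak-$^{\ast}$ topology, i.e., the initial topology with respect to the maps $B^\infty(G)\to\mathbb{K}$, $l \mapsto l(f)$, $f \in L^1(G)$; it is a compact Hausdorff space. For $g \in G$, $\lambda_G(g)\colon G \to G$, $x \mapsto gx$. The map $\alpha \colon G \times B^{\infty}(G) \to B^{\infty}(G)$, $\alpha(g,l)(f) = l(f\circ\lambda_G(g))$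 ($f \in L^1(G)$), is a continuous action of $G$ on $B^{\infty}(G)$. Entropy. Let $\alpha$ be a continuous action of a topological group $G$ on a compact Hausdorff space $X$. $\mathcal{C}(X)$ is the set of finite open coverings of $X$. For $\mathcal{U},\mathcal{V} \in \mathcal{C}(X)$ and $S \subseteq G$, write $\mathcal{U} \preceq_S^{\alpha} \mathcal{V}$ if for every $g \in S$ and every $V \in \mathcal{V}$ there is $U \in \mathcal{U}$ with $\alpha(g,V) = \{\alpha(g,x) \mid x\in V\} \subseteq U$. For compact $S \subseteq G$, $(S:\mathcal{U})_{\alpha} = \inf\{|\mathcal{V}| \mid \mathcal{V} \in \mathcal{C}(X),\ \mathcal{U} \preceq_S^{\alpha}\mathcal{V}\}$ (this is finite). For a compact generating subset $S$ of $G$, $\eta(\alpha,S,\mathcal{U}) = \limsup_{n\to\infty} \frac{\log_2 (S^n:\mathcal{U})_{\alpha}}{n}$. *)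

(* Defs.v *)
From HB Require Import structures.
From mathcomp Require Import all_boot all_order all_algebra.
From mathcomp Require Import all_classical all_reals all_analysis.
From mathcomp Require Import finmap measurable_realfun.
From mathcomp Require Import generic_quotient ring_quotient complex.

Set Implicit Arguments.
Unset Strict Implicit.
Unset Printing Implicit Defensive.

Import Order.TTheory GRing.Theory Num.Theory.
Import numFieldNormedType.Exports.

Local Open Scope classical_set_scope.
Local Open Scope ring_scope.

Variant scalar_kind := RealScalars | ComplexScalars.

Definition scalars (R : realType) (k : scalar_kind) : numFieldType :=
  match k with RealScalars => R | ComplexScalars => R[i] end.

Definition reK (R : realType) (k : scalar_kind) : scalars R k -> R :=
  match k return scalars R k -> R with
  | RealScalars => fun x => x
  | ComplexScalars => @complex.Re R
  end.

Definition imK (R : realType) (k : scalar_kind) : scalars R k -> R :=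
  match k return scalars R k -> R with
  | RealScalars => fun=> 0
  | ComplexScalars => @complex.Im R
  end.

Definition ofR (R : realType) (k : scalar_kind) : R -> scalars R k :=
  match k return R -> scalars R k with
  | RealScalars => fun x => x
  | ComplexScalars => fun x => x%:C%C
  end.

(* The norm of a numFieldType takes its values in that field; modK is the
   modulus as an element of R (see modKE). *)
Definition modK (R : realType) (k : scalar_kind) (z : scalars R k) : R :=
  reK `|z|.

Section scalars_theory.
Context (R : realType) (k : scalar_kind).
Local Notation K := (scalars R k).
Implicit Types (z w : K) (a b : R).

Lemma modKE z : `|z| = ofR k (modK z).
Proof. by case: k z => //= -[x y]. Qed.

Lemma reKD z w : reK (z + w) = reK z + reK w.
Proof. by case: k z w => //= -[x y] [x' y']. Qed.

Lemma imKD z w : imK (z + w) = imK z + imK w.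
Proof. by case: k z w => [z w|[x y] [x' y']] //=; rewrite addr0. Qed.

Lemma reKM z w : reK (z * w) = reK z * reK w - imK z * imK w.
Proof. by case: k z w => [z w|[x y] [x' y']] //=; rewrite mulr0 subr0. Qed.

Lemma imKM z w : imK (z * w) = reK z * imK w + imK z * reK w.
Proof. by case: k z w => [z w|[x y] [x' y']] //=; rewrite mulr0 mul0r addr0. Qed.

Lemma reK0 : reK (0 : K) = 0. Proof. by case: k. Qed.

Lemma imK0 : imK (0 : K) = 0. Proof. by case: k. Qed.

Lemma ofR0 : ofR k (0 : R) = 0. Proof. by case: k. Qed.

Lemma ofRD a b : ofR k (a + b) = ofR k a + ofR k b.
Proof. by case: k => //=; rewrite rmorphD. Qed.

Lemma ofRM a b : ofR k (a * b) = ofR k a * ofR k b.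
Proof. by case: k => //=; rewrite rmorphM. Qed.

Lemma ofR_le a b : (ofR k a <= ofR k b) = (a <= b).
Proof. by case: k => //=; rewrite lecR. Qed.

Lemma ofR_inj : injective (@ofR R k).
Proof. by case: k => //= a b []. Qed.

Lemma modK_ge0 z : 0 <= modK z.
Proof. by rewrite -ofR_le -modKE ofR0. Qed.

Lemma modKD z w : modK (z + w) <= modK z + modK w.
Proof. by rewrite -ofR_le ofRD -!modKE ler_normD. Qed.

Lemma modKM z w : modK (z * w) = modK z * modK w.
Proof. by apply: ofR_inj; rewrite ofRM -!modKE normrM. Qed.

Lemma modK0 : modK (0 : K) = 0.
Proof. by apply: ofR_inj; rewrite -modKE normr0 ofR0. Qed.

Lemma modK_eq0 z : modK z = 0 -> z = 0.
Proof. by move=> z0; apply/eqP; rewrite -normr_eq0 modKE z0 ofR0. Qed.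

Lemma modK_sqrt z : modK z = Num.sqrt (reK z ^+ 2 + imK z ^+ 2).
Proof.
by case: k z => [x|[x y]] //=; rewrite /modK /= expr0n addr0 sqrtr_sqr.
Qed.

Lemma modK_le z : modK z <= `|reK z| + `|imK z|.
Proof.
rewrite modK_sqrt -(@ler_pXn2r _ 2) ?nnegrE ?sqrtr_ge0 ?addr_ge0//.
rewrite sqr_sqrtr ?addr_ge0 ?sqr_ge0// sqrrD !real_normK ?num_real//.
by rewrite lerD2r lerDl mulrn_wge0// mulr_ge0.
Qed.

End scalars_theory.

Section L1fun.
Context (d : measure_display) (T : measurableType d) (R : realType).
Context (mu : {measure set T -> \bar R}) (k : scalar_kind).
Local Notation K := (scalars R k).

Definition L1pred : {pred T -> K^o} :=
  [pred f : T -> K^o |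
    `[< mu.-integrable [set: T] (EFin \o (fun x => reK (f x)))
      /\ mu.-integrable [set: T] (EFin \o (fun x => imK (f x))) >]].

Lemma L1pred_submod_closed : submod_closed L1pred.
Proof.
split=> [|a f g /asboolP[rf jf] /asboolP[rg jg]]; apply/asboolP; split.
- by apply: (eq_integrable _ (cst 0%E)) => // [x _|]; [rewrite /= reK0|
    exact: integrable0].
- by apply: (eq_integrable _ (cst 0%E)) => // [x _|]; [rewrite /= imK0|
    exact: integrable0].
- apply: (eq_integrable _ ((fun x => (reK a)%:E * (reK (f x))%:E)
      \+ (fun x => (- imK a)%:E * (imK (f x))%:E)
      \+ (EFin \o (fun x => reK (g x))))%E) => //.
    by move=> x _ /=; rewrite reKD reKM -!EFinM -!EFinD mulNr.
  by apply: integrableD => //; apply: integrableD => //; exact: integrableZl.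
- apply: (eq_integrable _ ((fun x => (reK a)%:E * (imK (f x))%:E)
      \+ (fun x => (imK a)%:E * (reK (f x))%:E)
      \+ (EFin \o (fun x => imK (g x))))%E) => //.
    by move=> x _ /=; rewrite imKD imKM -!EFinM -!EFinD.
  by apply: integrableD => //; apply: integrableD => //; exact: integrableZl.
Qed.

HB.instance Definition _ :=
  GRing.isSubmodClosed.Build K (T -> K^o) L1pred L1pred_submod_closed.

Record L1fun := MkL1fun { L1fun_val :> T -> K^o ; _ : L1fun_val \in L1pred }.

HB.instance Definition _ := [isSub for L1fun_val].
HB.instance Definition _ := [Choice of L1fun by <:].
HB.instance Definition _ := [SubChoice_isSubLmodule of L1fun by <:].

Implicit Types f g : L1fun.

Lemma measurable_reK f : measurable_fun [set: T] (fun x => reK (f x)).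
Proof.
by have /asboolP[/integrableP[/measurable_EFinP]] := valP f.
Qed.

Lemma measurable_imK f : measurable_fun [set: T] (fun x => imK (f x)).
Proof.
by have /asboolP[_ /integrableP[/measurable_EFinP]] := valP f.
Qed.

Lemma measurable_modK f : measurable_fun [set: T] (fun x => modK (f x)).
Proof.
under eq_fun do rewrite modK_sqrt.
apply: (@measurableT_comp _ _ _ _ _ _ (@Num.sqrt R)).
  exact: continuous_measurable_fun (@sqrt_continuous R).
by apply: measurable_funD; apply: measurable_funX;
  [exact: measurable_reK | exact: measurable_imK].
Qed.

Lemma integrable_modK f :
  mu.-integrable [set: T] (EFin \o (fun x => modK (f x))).
Proof.
have /asboolP[rf jf] := valP f.
apply: (le_integrable measurableT _ _
    (integrableD measurableT (integrable_abse rf) (integrable_abse jf))).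
  by apply/measurable_EFinP; exact: measurable_modK.
move=> x _ /=; rewrite lee_fin ger0_norm ?modK_ge0//.
by rewrite [leRHS]ger0_norm ?addr_ge0// modK_le.
Qed.

Definition L1fun_norm f : R := (\int[mu]_x modK (f x))%R.

Lemma L1fun_normE f :
  (L1fun_norm f)%:E = (\int[mu]_x (modK (f x))%:E)%E.
Proof.
by rewrite /L1fun_norm /Rintegral fineK//; exact: integrable_fin_num
  (integrable_modK f).
Qed.

Lemma L1fun_normD f g : L1fun_norm (f + g) <= L1fun_norm f + L1fun_norm g.
Proof.
rewrite -lee_fin EFinD !L1fun_normE -ge0_integralD//; first last.
- by apply/measurable_EFinP; exact: measurable_modK.
- by move=> x _; rewrite lee_fin modK_ge0.
- by apply/measurable_EFinP; exact: measurable_modK.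
- by move=> x _; rewrite lee_fin modK_ge0.
apply: ge0_le_integral => //.
- by move=> x _; rewrite lee_fin modK_ge0.
- by apply/measurable_EFinP; exact: measurable_modK.
- apply/measurable_EFinP/measurable_funD; exact: measurable_modK.
- by move=> x _; rewrite -EFinD lee_fin modKD.
Qed.

Lemma L1fun_normZ (a : K) f : L1fun_norm (a *: f) = modK a * L1fun_norm f.
Proof.
apply: EFin_inj; rewrite EFinM !L1fun_normE -ge0_integralZl//; first last.
- by rewrite lee_fin modK_ge0.
- by move=> x _; rewrite lee_fin modK_ge0.
- by apply/measurable_EFinP; exact: measurable_modK.
by apply: eq_integral => x _; rewrite -EFinM -modKM.
Qed.

Lemma L1fun_norm_eq0 f :
  L1fun_norm f = 0 <-> {ae mu, forall x, f x = 0}.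
Proof.
have mf : measurable_fun [set: T] (EFin \o (fun x => modK (f x))).
  by apply/measurable_EFinP; exact: measurable_modK.
have := ae_eq_integral_abs mu measurableT mf.
have -> : (\int[mu]_x `|(EFin \o (fun x => modK (f x))) x| =
    (L1fun_norm f)%:E)%E.
  rewrite L1fun_normE; apply: eq_integral => x _ /=.
  by rewrite ger0_norm ?modK_ge0.
move=> H; split.
  move=> f0; have /H : (L1fun_norm f)%:E = 0%E by rewrite f0.
  by apply: filterS => x fx; apply: modK_eq0; apply: EFin_inj; exact: fx.
move=> f0; apply: EFin_inj; apply/H; apply: filterS f0 => x fx _ /=.
by rewrite fx modK0.
Qed.

Definition L1null : {pred L1fun} :=
  [pred f : L1fun | `[< {ae mu, forall x, f x = 0} >]].

Lemma L1null_zmod_closed : zmod_closed L1null.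
Proof.
split=> [|f g /asboolP f0 /asboolP g0]; apply/asboolP; first exact: aeW.
by apply: filterS2 f0 g0 => x fx gx; rewrite -[LHS]/(f x - g x) fx gx subr0.
Qed.

HB.instance Definition _ := GRing.isZmodClosed.Build L1fun L1null
  L1null_zmod_closed.

Lemma L1fun_norm_null f g : f - g \in L1null -> L1fun_norm f = L1fun_norm g.
Proof.
move=> /asboolP/L1fun_norm_eq0 fg; apply/eqP; rewrite eq_le.
have gf : L1fun_norm (g - f) = 0.
  by rewrite -opprB -scaleN1r L1fun_normZ fg mulr0.
apply/andP; split.
  by rewrite -{1}(subrK g f) (le_trans (L1fun_normD _ _))// fg add0r.
by rewrite -{1}(subrK f g) (le_trans (L1fun_normD _ _))// gf add0r.
Qed.

End L1fun.

Arguments L1pred {d T R} mu k.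
Arguments L1null {d T R} mu k.

Section L1space.
Context (d : measure_display) (T : measurableType d) (R : realType).
Context (mu : {measure set T -> \bar R}) (k : scalar_kind).
Local Notation K := (scalars R k).
Local Open Scope quotient_scope.

Definition L1 : Type := Quotient.quot (L1null mu k).

HB.instance Definition _ := GRing.Zmodule.on L1.
HB.instance Definition _ := EqQuotient.on L1.
Implicit Types (u v : L1) (f g : L1fun mu k) (a b : K).

Lemma L1_eqP f g : f = g %[mod L1] <-> {ae mu, forall x, f x = g x}.
Proof.
split.
  move/eqP; rewrite -[_ == _]Quotient.idealrBE => /asboolP.
  by apply: filterS => x /eqP; rewrite subr_eq0 => /eqP.
move=> fg; apply/eqP; rewrite -[_ == _]Quotient.idealrBE; apply/asboolP.
by apply: filterS fg => x fg; rewrite -[LHS]/(f x - g x) fg subrr.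
Qed.

Lemma pi_L1D f g : \pi_L1 (f + g) = \pi_L1 f + \pi_L1 g.
Proof. exact: Quotient.pi_add. Qed.

Lemma pi_L10 : \pi_L1 0 = 0.
Proof. exact: pi_zeror. Qed.

Definition L1_scale a u : L1 := \pi_L1 (a *: repr u).

Lemma pi_L1_scale a f : \pi_L1 (a *: f) = L1_scale a (\pi_L1 f).
Proof.
rewrite /L1_scale; apply/L1_eqP.
have /L1_eqP : f = repr (\pi_L1 f) %[mod L1] by rewrite reprK.
by apply: filterS => x fx; rewrite -[LHS]/(a *: f x) fx.
Qed.

Lemma L1_scaleA a b u : L1_scale a (L1_scale b u) = L1_scale (a * b) u.
Proof. by elim/quotW: u => f; rewrite -(pi_L1_scale b) -!pi_L1_scale scalerA. Qed.

Lemma L1_scale1 : left_id 1 L1_scale.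
Proof. by elim/quotW => f; rewrite -pi_L1_scale scale1r. Qed.

Lemma L1_scaleDr : right_distributive L1_scale +%R.
Proof.
move=> a; elim/quotW => f; elim/quotW => g.
by rewrite -pi_L1D -!pi_L1_scale scalerDr pi_L1D.
Qed.

Lemma L1_scaleDl u : {morph L1_scale^~ u : a b / a + b}.
Proof.
by move=> a b; elim/quotW: u => f; rewrite -!pi_L1_scale scalerDl pi_L1D.
Qed.

HB.instance Definition _ := GRing.Zmodule_isLmodule.Build K L1
  L1_scaleA L1_scale1 L1_scaleDr L1_scaleDl.

Lemma pi_L1Z a f : \pi_L1 (a *: f) = a *: \pi_L1 f.
Proof. exact: pi_L1_scale. Qed.

Definition L1_norm u : K := ofR k (L1fun_norm (repr u)).

Lemma L1_norm_pi f : L1_norm (\pi_L1 f) = ofR k (L1fun_norm f).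
Proof.
congr ofR; apply: L1fun_norm_null.
by rewrite Quotient.idealrBE reprK.
Qed.

Lemma L1_normD u v : L1_norm (u + v) <= L1_norm u + L1_norm v.
Proof.
elim/quotW: u => f; elim/quotW: v => g.
by rewrite -pi_L1D !L1_norm_pi -ofRD ofR_le L1fun_normD.
Qed.

Lemma L1_normZ a u : L1_norm (a *: u) = `|a| * L1_norm u.
Proof.
by elim/quotW: u => f; rewrite -pi_L1Z !L1_norm_pi L1fun_normZ ofRM -modKE.
Qed.

Lemma L1_norm_eq0 u : L1_norm u = 0 -> u = 0.
Proof.
elim/quotW: u => f; rewrite L1_norm_pi -(ofR0 R k) => /ofR_inj/L1fun_norm_eq0.
by move=> f0; rewrite -pi_L10; apply/L1_eqP.
Qed.

HB.instance Definition _ := Lmodule_isNormed.Build K L1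
  L1_normD L1_normZ L1_norm_eq0.

Lemma normr_pi_L1 f : `|\pi_L1 f| = ofR k (\int[mu]_x modK (f x)).
Proof. exact: L1_norm_pi. Qed.

End L1space.
Arguments L1 {d T R} mu k.

Section dual_ball.
Context (K : numFieldType) (V : normedModType K).

(* The operator norm of a linear functional is at most 1 exactly when it
   satisfies dual_ball_le, which in particular makes it continuous. *)
Record dual_ball := DualBall {
  dual_fun :> {linear V -> K^o} ;
  dual_ball_le : forall u, `|dual_fun u| <= `|u| }.

HB.instance Definition _ := gen_eqMixin dual_ball.
HB.instance Definition _ := gen_choiceMixin dual_ball.

HB.instance Definition _ := Topological.copy dual_ball
  (sup_topology (fun u : V => Topological.on
    (initial_topology (fun l : dual_ball => l u : K^o)))).

End dual_ball.

HB.mixin Record isTopologicalGroup G & Topological G & Group G := {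
  mulg_continuous : continuous (fun x : G * G => (x.1 * x.2)%g) ;
  invg_continuous : continuous (fun x : G => (x^-1)%g) }.

#[short(type="topologicalGroupType")]
HB.structure Definition TopologicalGroup :=
  {G of Topological G & Group G & isTopologicalGroup G}.

Definition identity_component (G : topologicalGroupType) : set G :=
  connected_component [set: G] 1%g.
Arguments identity_component : clear implicits.

Section quotient_by_component.
Context (G : topologicalGroupType).

Definition same_coset : rel G := fun x y =>
  `[< [set (x * n)%g | n in identity_component G]
    = [set (y * n)%g | n in identity_component G] >].

Lemma same_coset_equiv : equiv_class_of same_coset.
Proof.
split=> [x|x y|y x z]; first exact/asboolP.
  by apply/asboolP/asboolP => ->.
by move=> /asboolP xy /asboolP yz; apply/asboolP; rewrite xy yz.
Qed.

Canonical same_coset_rel := EquivRelPack same_coset_equiv.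
Canonical same_coset_encModRel := defaultEncModRel same_coset.

Definition component_quotient : Type :=
  quotient_topology {eq_quot same_coset}%qT.

HB.instance Definition _ := Topological.on component_quotient.

End quotient_by_component.

Definition almost_connected (G : topologicalGroupType) : Prop :=
  compact [set: component_quotient G].

Definition setpow (G : topologicalGroupType) (S : set G) (n : nat) : set G :=
  [set (\prod_(i < n) s i)%g | s in [set s : 'I_n -> G | forall i, S (s i)]].

Definition generates (G : topologicalGroupType) (S : set G) : Prop :=
  S 1%g /\ \bigcup_(n in [set n | (0 < n)%N]) setpow S n = [set: G].

(* Measurable spaces are pointed in the library: the base point is 1. *)
Definition pointed_group (G : topologicalGroupType) : Type := G.

HB.instance Definition _ (G : topologicalGroupType) :=
  Topological.on (pointed_group G).
HB.instance Definition _ (G : topologicalGroupType) :=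
  isPointed.Build (pointed_group G) (1%g : G).

Definition borel (G : topologicalGroupType) : Type :=
  g_sigma_algebraType (@open (pointed_group G)).

HB.instance Definition _ (G : topologicalGroupType) := Measurable.on (borel G).

Section haar.
Context (G : topologicalGroupType) (R : realType).
Context (mu : {measure set (borel G) -> \bar R}).

Definition lmul (g : G) : borel G -> borel G := fun x => (g * (x : G))%g.

(* Radon in the sense: finite on compact sets, outer regular on Borel sets,
   inner regular on open sets. *)
Record left_haar_measure : Prop := LeftHaarMeasure {
  haar_neq0 : mu [set: borel G] != 0%E ;
  haar_invariant : forall (g : G) (A : set (borel G)), measurable A ->
    mu (lmul g @` A) = mu A ;
  haar_compact : forall C : set G, compact C -> (mu C < +oo)%E ;
  haar_outer_regular : forall A : set (borel G), measurable A ->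
    mu A = ereal_inf [set mu U | U in [set U : set G | open U /\ A `<=` U]] ;
  haar_inner_regular : forall U : set G, open U ->
    mu U = ereal_sup [set mu C | C in [set C : set G | compact C /\ C `<=` U]]
}.

End haar.

Section haar_translation.
Context (G : topologicalGroupType) (R : realType).
Context (mu : {measure set (borel G) -> \bar R}) (hmu : left_haar_measure mu).

Lemma lmul_continuous (g : G) : continuous (lmul g : G -> G).
Proof.
move=> x; apply: (@continuous_comp _ _ _ (fun x : G => (g, x))
  (fun z : G * G => (z.1 * z.2)%g)); last exact: mulg_continuous.
by apply: cvg_pair => //=; exact: cvg_cst.
Qed.

Lemma measurable_lmul (g : G) : measurable_fun [set: borel G] (lmul g).
Proof.
refine (@measurability _ _ (borel G) (borel G) [set: borel G] (lmul g) (@open (pointed_group G)) _ _) => //.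
move=> _ [U oU <-]; rewrite setTI; apply: sub_sigma_algebra.
by move: U oU; apply/continuousP; exact: lmul_continuous.
Qed.

Lemma lmul_preimage (g : G) (A : set (borel G)) :
  lmul g @^-1` A = lmul (g^-1)%g @` A.
Proof.
rewrite eqEsubset; split=> [x Ax|_ [x Ax <-]]; last first.
  by rewrite /preimage /lmul /= mulVKg.
by exists (lmul g x) => //; rewrite /lmul mulKg.
Qed.

Lemma haar_integral (g : G) (h : borel G -> \bar R) :
  measurable_fun [set: borel G] h -> (forall x, 0 <= h x)%E ->
  (\int[mu]_x h (lmul g x) = \int[mu]_x h x)%E.
Proof.
move=> mh h0.
have mg := measurable_lmul g.
have := @ge0_integral_pushforward _ _ _ _ R _ mg mu [set: borel G] h
  measurableT mh (fun x _ => h0 x).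
rewrite preimage_setT => <-; apply: eq_measure_integral => A mA _.
by rewrite -(haar_invariant hmu g^-1%g mA) -lmul_preimage.
Qed.

Context (k : scalar_kind).
Local Notation K := (scalars R k).
Implicit Types (g : G) (f : L1fun mu k) (u v : L1 mu k).

Lemma haar_integrable g (h : borel G -> R) :
  mu.-integrable [set: borel G] (EFin \o h) ->
  mu.-integrable [set: borel G] (EFin \o (h \o lmul g)).
Proof.
move=> /integrableP[mh ih]; apply/integrableP; split.
  exact: (measurableT_comp mh (measurable_lmul g)).
rewrite -(haar_integral g) in ih => //.
by apply: measurableT_comp.
Qed.

Lemma L1fun_translate_subproof g f : (f \o lmul g : _ -> K^o) \in L1pred mu k.
Proof.
have /asboolP[rf jf] := valP f; apply/asboolP; split.
  exact: haar_integrable rf.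
exact: haar_integrable jf.
Qed.

Definition L1fun_translate g f : L1fun mu k :=
  MkL1fun (L1fun_translate_subproof g f).

Local Open Scope quotient_scope.

Definition L1_translate g u : L1 mu k :=
  \pi_(L1 mu k) (L1fun_translate g (repr u)).

Lemma L1_translate_pi g f :
  L1_translate g (\pi_(L1 mu k) f) = \pi_(L1 mu k) (L1fun_translate g f).
Proof.
rewrite /L1_translate; apply/L1_eqP.
have /L1_eqP : repr (\pi_(L1 mu k) f) = f %[mod L1 mu k] by rewrite reprK.
move=> [N [mN N0 subN]]; exists (lmul g @^-1` N); split.
- by rewrite -[X in measurable X]setTI; exact: measurable_lmul.
- by rewrite lmul_preimage haar_invariant.
- by move=> x /= nx; apply: subN.
Qed.

Lemma L1_translate_linear g : linear (L1_translate g).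
Proof.
move=> a; elim/quotW => f; elim/quotW => f'.
by rewrite -pi_L1Z -pi_L1D !L1_translate_pi -pi_L1Z -pi_L1D; congr (\pi_(_) _);
  apply: val_inj.
Qed.

HB.instance Definition _ g := GRing.isLinear.Build K (L1 mu k) (L1 mu k) _
  (L1_translate g) (L1_translate_linear g).

Lemma L1_translate_norm g u : `|L1_translate g u| = `|u|.
Proof.
elim/quotW: u => f; rewrite L1_translate_pi !normr_pi_L1; congr (ofR _ _).
congr fine; apply: (haar_integral g (h := fun x => (modK (f x))%:E)).
  by apply/measurable_EFinP; exact: measurable_modK.
by move=> x; rewrite lee_fin modK_ge0.
Qed.

Definition Binfty : topologicalType := dual_ball (L1 mu k).

Lemma canonical_action_subproof g (l : Binfty) u :
  `|((l : {linear L1 mu k -> K^o}) \o L1_translate g) u| <= `|u|.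
Proof. by rewrite -(L1_translate_norm g u) /=; exact: dual_ball_le. Qed.

Definition canonical_action g (l : Binfty) : Binfty :=
  DualBall (dual_fun := (l : {linear L1 mu k -> K^o}) \o L1_translate g)
    (canonical_action_subproof g l).

Lemma canonical_actionE g (l : Binfty) u :
  canonical_action g l u = l (L1_translate g u).
Proof. by []. Qed.

End haar_translation.
Arguments Binfty {G R} mu k.
Arguments canonical_action {G R mu} hmu k g l.

Definition finite_open_cover (X : topologicalType) : set (set (set X)) :=
  [set V | finite_set V /\ (forall A, V A -> open A) /\
           \bigcup_(A in V) A = [set: X]].

Section entropy.
Context (R : realType) (G : topologicalGroupType) (X : topologicalType).
Context (alpha : G -> X -> X).
Implicit Types (S : set G) (U V : set (set X)).

Definition refines_along S U V : Prop :=
  forall g B, S g -> V B -> exists2 A, U A & alpha g @` B `<=` A.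

(* inf is taken in R, where inf set0 = 0; for S compact and alpha continuous on a
   compact X, the set below is nonempty. *)
Definition cover_number S U : R :=
  inf [set (#|` fset_set V|)%:R | V in
        [set V | finite_open_cover V /\ refines_along S U V]].

Definition log2 (x : R) : R := ln x / ln 2.

Definition eta S U : \bar R :=
  limn_esup (fun n => (log2 (cover_number (setpow S n) U) / n%:R)%:E).

End entropy.

(* Main.v *)
(* Let [C] be a compact set of positive measure and [u] its indicator,
   normalized in L^1.  If the sets [g_i^-1 C], for [i < m] and [g_i] in [S^n], are
   pairwise disjoint, then integration over the union of any subfamily gives a
   functional in the unit ball whose translates by the [g_i] take the values 0
   and 1 at [u], in any prescribed pattern.  Hence the cover by the two half-spaces
   [0 < Re l(u)] and [Re l(u) < 1] has covering number at least [2^m] along [S^n].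

   Steinhaus' theorem shows that some [S^p] is a neighbourhood of 1.  Given [N],
   choose [W], open and symmetric around 1, with [W^(2N)] inside [S^p].  The powers
   of [W] strictly increase: otherwise the open subgroup they generate would be
   relatively compact, and of finite index as [G] is almost connected.  Taking
   [g_i] in [W^(2i+2)] but not in [W^(2i+1)] gives [g_j g_i^-1] outside [W] for
   distinct [i] and [j], which is the required disjointness when [C C^-1] lies in
   [W].  So [S^(pj)] contains [N j] such points and the entropy is at least [N/p],
   where [p] does not depend on [N]. *)

From HB Require Import structures.
Require Import Defs.
From mathcomp Require Import all_boot all_order all_algebra finmap.
From mathcomp Require Import generic_quotient ring_quotient.
From mathcomp Require Import all_classical all_reals all_analysis.
From mathcomp Require Import measurable_realfun complex ring lra.

Set Implicit Arguments.
Unset Strict Implicit.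
Unset Printing Implicit Defensive.

Import Order.TTheory GRing.Theory Num.Theory.
Import numFieldNormedType.Exports.

Local Open Scope classical_set_scope.
Local Open Scope ring_scope.

(* The library states [compact_cover] for pointed spaces only. *)
Lemma compact_cover_compact (T : topologicalType) (A : set T) :
  compact A -> cover_compact A.
Proof.
have [->|/set0P[x _]] := eqVneq A set0; first by move=> _ I D f _ _; exists fset0.
pose P : ptopologicalType :=
  HB.pack_for ptopologicalType T (isPointed.Build T x).
by move=> cA; have := cA : @compact P A; rewrite compact_cover.
Qed.

(** * Powers of subsets *)

Section setpow_theory.
Context (G : topologicalGroupType).
Implicit Types (S T : set G) (m n p : nat).

Lemma setpow0 S : setpow S 0 = [set 1%g].
Proof.
rewrite eqEsubset; split=> [_ [s _ <-]|_ ->]; first by rewrite big_ord0.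
by exists (fun=> 1%g) => [[]|]//; rewrite big_ord0.
Qed.

Lemma setpowS S n :
  setpow S n.+1 = [set (x * y)%g | x in S & y in setpow S n].
Proof.
rewrite eqEsubset; split=> [_ [s Ss <-]|_ [x Sx [_ [s Ss <-] <-]]].
  rewrite big_ord_recl; exists (s ord0) => //.
  by exists (\prod_(i < n) s (lift ord0 i))%g => //;
    exists (s \o lift ord0) => //= i; exact: Ss.
(* The family [s] with [x] prepended at index 0. *)
exists (fun i => if unlift ord0 i is Some j then s j else x).
  by move=> i /=; case: unlift => [j|] //; exact: Ss.
rewrite big_ord_recl unlift_none; congr (_ * _)%g.
by apply: eq_bigr => i _; rewrite liftK.
Qed.

Lemma setpow1 S : setpow S 1 = S.
Proof.
rewrite setpowS setpow0 eqEsubset; split=> [_ [x Sx [_ -> <-]]|x Sx].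
  by rewrite mulg1.
by exists x => //; exists 1%g; rewrite ?mulg1.
Qed.

Lemma setpowD S m n : 
  setpow S (m + n) = [set (x * y)%g | x in setpow S m & y in setpow S n].
Proof.
elim: m => [|m IH].
  rewrite add0n setpow0 eqEsubset; split=> [x Sx|_ [_ -> [y Sy <-]]].
    by exists 1%g => //; exists x => //; rewrite mul1g.
  by rewrite mul1g.
rewrite addSn !setpowS IH eqEsubset; split.
  move=> _ [x Sx [_ [y Sy [z Sz <-]] <-]].
  by exists (x * y)%g; [exists x => //; exists y|exists z => //; rewrite mulgA].
move=> _ [_ [x Sx [y Sy <-]] [z Sz <-]]; exists x => //.
by exists (y * z)%g; [exists y => //; exists z|rewrite mulgA].
Qed.

Lemma setpow_mul S m n x y :
  setpow S m x -> setpow S n y -> setpow S (m + n) (x * y)%g.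
Proof. by move=> Sx Sy; rewrite setpowD; exists x => //; exists y. Qed.

Lemma setpow_subset S T n : S `<=` T -> setpow S n `<=` setpow T n.
Proof. by move=> ST _ [s Ss <-]; exists s => // i; exact: ST (Ss i). Qed.

Lemma setpow_setpow S p n : setpow (setpow S p) n = setpow S (p * n).
Proof.
elim: n => [|n IH]; first by rewrite muln0 !setpow0.
by rewrite setpowS mulnS setpowD IH.
Qed.

Lemma setpow_mem1 S n : S 1%g -> setpow S n 1%g.
Proof. by move=> S1; exists (fun=> 1%g) => //; rewrite big1. Qed.

Lemma setpow_leq S m n : S 1%g -> (m <= n)%N -> setpow S m `<=` setpow S n.
Proof.
move=> S1 /subnKC <- x Sx; rewrite -[x]mulg1.
exact: setpow_mul Sx (setpow_mem1 _ S1).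
Qed.

Lemma setpow_inv S n x : (forall y, S y -> S y^-1%g) ->
  setpow S n x -> setpow S n x^-1%g.
Proof.
move=> SV; elim: n x => [|n IH] x; first by rewrite !setpow0 => ->; rewrite invg1.
rewrite {1}setpowS -addn1 => -[y Sy [z Sz <-]]; rewrite invgM.
by apply: setpow_mul; [exact: IH|rewrite setpow1; exact: SV].
Qed.

End setpow_theory.

(** * Topological groups *)

Section topological_group_theory.
Context (G : topologicalGroupType).
Implicit Types (A B C S T U V W : set G) (x y g : G) (m n : nat).

Lemma mulgl_continuous g : continuous (fun x : G => (g * x)%g).
Proof. exact: lmul_continuous. Qed.

Lemma mulgr_continuous g : continuous (fun x : G => (x * g)%g).
Proof.
move=> x; apply: (@continuous_comp _ _ _ (fun x : G => (x, g))
  (fun z : G * G => (z.1 * z.2)%g)); last exact: mulg_continuous.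
by apply: cvg_pair => //=; exact: cvg_cst.
Qed.

Lemma compact_mul A B : compact A -> compact B ->
  compact [set (x * y)%g | x in A & y in B].
Proof.
move=> cA cB.
rewrite (_ : image2 _ _ _ = (fun z : G * G => (z.1 * z.2)%g) @` (A `*` B)).
  apply: continuous_compact; last exact: compact_setX.
  exact/continuous_subspaceT/mulg_continuous.
rewrite eqEsubset; split=> [_ [x Ax [y By <-]]|_ [[x y] [/= Ax By] <-]].
  by exists (x, y).
by exists x => //; exists y.
Qed.

Lemma compact_inv A : compact A -> compact ((fun x : G => x^-1%g) @^-1` A).
Proof.
move=> cA; rewrite (_ : _ @^-1` A = (fun x : G => x^-1%g) @` A).
  apply: continuous_compact => //.
  exact/continuous_subspaceT/invg_continuous.
rewrite eqEsubset; split=> [x Ax|_ [x Ax <-]]; last by rewrite /preimage /= invgK.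
by exists x^-1%g => //; rewrite invgK.
Qed.

Lemma compact_setpow S n : compact S -> compact (setpow S n).
Proof.
move=> cS; elim: n => [|n IH]; first by rewrite setpow0; exact: compact_set1.
by rewrite setpowS; exact: compact_mul.
Qed.

Lemma nbhs1_mul V : nbhs 1%g V -> exists2 U, nbhs 1%g U &
  forall x y, U x -> U y -> V (x * y)%g.
Proof.
move=> V1; have := @mulg_continuous G (1%g, 1%g) V.
rewrite /= mulg1 => /(_ V1) [[A B] [/= A1 B1] AB].
exists (A `&` B); first exact: filterI.
by move=> x y [Ax _] [_ By]; exact: (AB (x, y)).
Qed.

Lemma nbhs1_setpow V n : nbhs 1%g V -> exists2 U, nbhs 1%g U & setpow U n `<=` V.
Proof.
elim: n V => [|n IH] V V1.
  by exists V => //; rewrite setpow0 => _ ->; exact: nbhs_singleton.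
have [U U1 UV] := nbhs1_mul V1; have [T T1 TU] := IH _ U1.
exists (U `&` T); first exact: filterI.
rewrite setpowS => _ [x [Ux Tx] [y Uy <-]]; apply: UV => //.
by apply: TU; apply: setpow_subset y Uy; exact: subIsetr.
Qed.

Lemma nbhs1_sym_open V : nbhs 1%g V -> exists W,
  [/\ open W, W 1%g, W `<=` V & forall x, W x -> W x^-1%g].
Proof.
rewrite nbhsE => -[U [oU U1] UV].
exists (U `&` (fun x : G => x^-1%g) @^-1` U); split.
- by apply: openI => //; move/continuousP: (@invg_continuous G); apply.
- by split => //; rewrite /preimage /= invg1.
- by apply: subset_trans UV; exact: subIsetl.
- by move=> x [Ux Vx]; split => //; rewrite /preimage /= invgK.
Qed.

(** A tube lemma: continuity of the product at [(1, y)] gives a neighbourhood of 1 for points near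
    [y], and compactness of [C] makes one neighbourhood serve all [y]. *)
Lemma nbhs_mul_sub C U : compact C -> open U -> C `<=` U ->
  nbhs 1%g [set x | forall y, C y -> U (x * y)%g].
Proof.
move=> /compact_near_coveringP cC oU CU.
have := cC _ (nbhs (1%g : G)) (fun x y => U (x * y)%g) _.
apply => x Cx.
have := @mulg_continuous G (1%g, x) U.
rewrite /= mul1g => /(_ (open_nbhs_nbhs (conj oU (CU _ Cx)))) [[A B] [/= A1 B1] AB].
by exists (B, A) => // -[a b] [/= Ba Ab]; exact: (AB (b, a)).
Qed.

(** A connected set through 1 meets the clopen set [A], so it lies inside it. *)
Lemma identity_component_sub A :
  open A -> closed A -> A 1%g -> identity_component G `<=` A.
Proof.
move=> oA clA A1 x [B [B1 _ cB] Bx].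
suff BA : B `&` A = B by move: Bx; rewrite -BA => -[].
apply: cB; first by exists 1%g.
- by exists A.
- by exists A.
Qed.

(** The complement is a union of left cosets of [A], which are open. *)
Lemma open_subgroup_closed A : open A -> A 1%g ->
  (forall x y, A x -> A y -> A (x * y)%g) -> (forall x, A x -> A x^-1%g) ->
  closed A.
Proof.
move=> oA A1 AM AV; rewrite -[A]setCK; apply: open_closedC.
rewrite openE => x nAx.
have : nbhs x ((fun y => x^-1 * y)%g @^-1` A).
  by apply: mulgl_continuous; rewrite mulVg; exact: open_nbhs_nbhs.
apply: filterS => y Axy Ay; apply: nAx.
rewrite (_ : x = y * (x^-1 * y)^-1)%g; first by apply: AM => //; exact: AV.
by rewrite invgM invgK mulVKg.
Qed.

(** The open subgroup [A] contains the identity component, so its left cosets induce an open cover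
    of the compact quotient. Finitely many cosets thus fill [G], each inside a translate of [C]. *)
Lemma compact_almost_connected A C : almost_connected G -> open A -> A 1%g ->
  (forall x y, A x -> A y -> A (x * y)%g) -> (forall x, A x -> A x^-1%g) ->
  A `<=` C -> compact C -> compact [set: G].
Proof.
move=> + oA A1 AM AV AC cC => /compact_cover_compact.
have NA := identity_component_sub oA (open_subgroup_closed oA A1 AM AV) A1.
have N1 : identity_component G 1%g by exact: connected_component_refl.
pose pi : G -> component_quotient G := \pi_(component_quotient G)%qT.
(* The chosen representative of the class of [x] differs from [x] by a right factor in the identity
   component. *)
have pi_coset x : A (x^-1 * repr (pi x))%g.
  have /eqquotP/asboolP/seteqP[+ _] :
      repr (pi x) = x %[mod {eq_quot (@same_coset G)}]%qT.
    by rewrite [LHS]reprK.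
  move=> /(_ (repr (pi x))) [].
    by exists 1%g => //; rewrite mulg1.
  by move=> n Nn <-; rewrite mulKg; exact: NA.
(* Membership in the coset [gA] does not depend on the representative, so the member of the cover
   indexed by [g] has preimage [gA] in [G]. *)
have pi_A g x : A (g^-1 * repr (pi x))%g <-> A (g^-1 * x)%g.
  split=> Ag.
    rewrite (_ : g^-1 * x = g^-1 * repr (pi x) * (x^-1 * repr (pi x))^-1)%g.
      by apply: AM => //; exact: AV.
    by rewrite invgM invgK -mulgA mulVKg.
  by rewrite -[repr _](mulVKg x) mulgA; exact: AM.
move=> /(_ G setT (fun g => [set q | A (g^-1 * repr q)%g])) [].
- move=> g _; rewrite /open /= /quotient_open.
  rewrite (_ : _ @^-1` _ = (fun x => g^-1 * x)%g @^-1` A); last first.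
    by apply/seteqP; split=> x /= /pi_A.
  by move: oA; move/continuousP: (@mulgl_continuous g^-1%g); apply.
- by move=> q _; exists (repr q) => //=; rewrite mulVg.
move=> D _ DA.
have -> : [set: G] = \bigcup_(g in [set` D]) (fun x => g * x)%g @` C.
  apply/seteqP; split=> // x _; have [g Dg /pi_A Ax] := DA (pi x) I.
  by exists g => //; exists (g^-1 * x)%g; [exact: AC|rewrite mulVKg].
rewrite bigcup_fset; apply: bigsetU_compact => g _.
apply: continuous_compact => //.
exact/continuous_subspaceT/mulgl_continuous.
Qed.

(** If [W^(n+1)] were inside [W^n], the powers would stabilize to an open subgroup contained in a
    compact set, making [G] compact. *)
Lemma setpow_escape W : almost_connected G -> ~ compact [set: G] ->
  open W -> W 1%g -> (forall x, W x -> W x^-1%g) ->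
  (forall n, exists2 C, compact C & setpow W n `<=` C) ->
  forall n, exists2 g, setpow W n.+1 g & ~ setpow W n g.
Proof.
move=> acG ncG oW W1 WV WC n; apply: contrapT => nesc; apply: ncG.
have Wn m : setpow W m `<=` setpow W n.
  elim: m => [|m IH]; first by rewrite setpow0 => _ ->; exact: setpow_mem1.
  rewrite setpowS => _ [x Wx [y Wy <-]]; apply: contrapT => nW; apply: nesc.
  by exists (x * y)%g => //; rewrite setpowS; exists x => //; exists y => //; exact: IH.
have [C cC WnC] := WC n.+1.
(* The exponent [n.+1] provides a factor from the open set [W], hence openness even for [n = 0],
   where [W^n] is only the singleton of 1. *)
apply: (@compact_almost_connected (setpow W n.+1) C) => //.
- rewrite setpowS openE => _ [x Wx [y Wy <-]].
  have : nbhs (x * y)%g ((fun z => z * y^-1)%g @^-1` W).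
    by apply: mulgr_continuous; rewrite mulgK; exact: open_nbhs_nbhs.
  by apply: filterS => z Wz; exists (z * y^-1)%g => //; exists y => //; rewrite mulgVK.
- exact: setpow_mem1.
- move=> x y Wx Wy.
  by apply: (setpow_leq W1 (leqnSn n)); apply: (Wn _ _ (setpow_mul Wx Wy)).
- by move=> x; exact: setpow_inv.
Qed.

(** The exponents advance by two to leave room for one more factor from [W]: for [i < j], [g j] in
    [W (g i)] would lie in [W^(2i+3)], a part of the excluded [W^(2j+1)]. *)
Lemma setpow_separated W : almost_connected G -> ~ compact [set: G] ->
  open W -> W 1%g -> (forall x, W x -> W x^-1%g) ->
  (forall n, exists2 C, compact C & setpow W n `<=` C) ->
  exists2 g : nat -> G, (forall i, setpow W i.*2.+2 (g i)) &
    forall i j, i != j -> ~ W (g j * (g i)^-1)%g.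
Proof.
move=> acG ncG oW W1 WV WC.
have /choice[g gP] i : exists g, setpow W i.*2.+2 g /\ ~ setpow W i.*2.+1 g.
  have [g Wg nWg] := setpow_escape acG ncG oW W1 WV WC i.*2.+1.
  by exists g.
have sep i j : (i < j)%N -> ~ W (g j * (g i)^-1)%g.
  move=> ij Wji; apply: (gP j).2.
  apply: (@setpow_leq _ W i.*2.+3) => //; first by rewrite ltnS -doubleS leq_double.
  rewrite setpowS; exists (g j * (g i)^-1)%g => //.
  by exists (g i); [exact: (gP i).1|rewrite mulgVK].
exists g => [i|i j]; first exact: (gP i).1.
rewrite neq_ltn => /orP[|ji]; first exact: sep.
move=> /WV; rewrite invgF; exact: sep.
Qed.

End topological_group_theory.

(** * Haar measure *)

Section haar_theory.
Context (G : topologicalGroupType) (R : realType).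
Context (mu : {measure set (borel G) -> \bar R}) (hmu : left_haar_measure mu).
Context (hausG : hausdorff_space G).
Implicit Types (A C K S U : set (borel G)) (x g : G).

Lemma open_borel (U : set G) : open U -> measurable (U : set (borel G)).
Proof. by move=> oU; exact: sub_sigma_algebra. Qed.

Lemma compact_borel (C : set G) : compact C -> measurable (C : set (borel G)).
Proof.
move=> /(compact_closed hausG) /closed_openC /open_borel /measurableC.
by rewrite setCK.
Qed.

Lemma measurable_lmul_image g A : measurable A -> measurable (lmul g @` A).
Proof.
move=> mA; rewrite -[g]invgK -lmul_preimage -[X in measurable X]setTI.
exact: measurable_lmul.
Qed.

Lemma haar_thickening (K : set G) (e : R) : compact K -> 0 < e -> exists2 U : set G,
  [/\ open U, K `<=` U & (mu U < mu K + e%:E)%E] &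
  nbhs 1%g [set x | lmul x @` K `<=` U].
Proof.
move=> cK e0; have mK := compact_borel cK.
have : (mu K < mu K + e%:E)%E.
  rewrite lteDl ?lte_fin// ge0_fin_numE ?measure_ge0//.
  exact: (haar_compact hmu cK).
rewrite {1}(haar_outer_regular hmu mK) => /ereal_inf_lt[_ [U [oU KU] <-] muU].
exists U => //; apply: filterS (nbhs_mul_sub cK oU KU) => x xKU.
by move=> _ [y Ky <-]; exact: xKU.
Qed.

(** For [x] near 1 the translate stays in an outer approximation [U] of [K], and [U \ K] has measure
    below [e] because [mu K] is finite. *)
Lemma haar_translate_small (K : set G) (e : R) : compact K -> 0 < e ->
  nbhs 1%g [set x | (mu (lmul x @` K `\` K) < e%:E)%E].
Proof.
move=> cK e0; have [U [oU KU muU]] := haar_thickening cK e0.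
have mK := compact_borel cK; have mU := open_borel oU.
apply: filterS => x xKU /=.
have muUK : (mu (U `\` K) < e%:E)%E.
  move: muU; rewrite (measureDI mu mU mK) setIidr// addeC lteD2lE//.
  by rewrite ge0_fin_numE ?measure_ge0//; exact: (haar_compact hmu cK).
apply: le_lt_trans muUK; apply: le_measure; rewrite ?inE.
- by apply: measurableD => //; exact: measurable_lmul_image.
- exact: measurableD.
- exact: setSD.
Qed.

(** For [x] near 1, [xC \ C] has measure less than [mu C = mu (xC)], so [xC] meets [C]. *)
Lemma steinhaus (C : set G) : compact C -> (0 < mu C)%E ->
  nbhs 1%g [set (x * y^-1)%g | x in C & y in C].
Proof.
move=> cC C0; have mC := compact_borel cC.
have Cfin : mu C \is a fin_num.
  by rewrite ge0_fin_numE ?measure_ge0//; exact: (haar_compact hmu cC).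
have muC0 : 0 < fine (mu C) by rewrite fine_gt0// C0 -ge0_fin_numE ?measure_ge0.
apply: filterS (haar_translate_small cC muC0) => x /= xC.
have [disj|/set0P[y [[z Cz xz] Cy]]] := eqVneq (lmul x @` C `&` C) set0.
  move: xC; rewrite setDE setIidl; last exact/disjoints_subset.
  by rewrite (haar_invariant hmu) // fineK// ltxx.
by exists y => //; exists z => //; rewrite -xz /lmul mulgK.
Qed.

Lemma haar_gt0_compact : exists2 C : set G, compact C & (0 < mu C)%E.
Proof.
have : (0 < mu [set: borel G])%E by rewrite lt0e (haar_neq0 hmu) measure_ge0.
rewrite (haar_inner_regular hmu openT) => /ereal_sup_gt[_ [C [cC _] <-] C0].
by exists C.
Qed.

(** Finitely many translates of [U] cover any given compact set; if [U] were null, every compact set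
    would be null. *)
Lemma haar_open_gt0 (U : set G) : open U -> U 1%g -> (0 < mu U)%E.
Proof.
move=> oU U1; rewrite lt0e measure_ge0 andbT; apply/eqP => U0.
have [C cC] := haar_gt0_compact; apply/negP; rewrite -leNgt.
have oxU x : open (lmul x @` U).
  rewrite -[x]invgK -lmul_preimage; move: oU.
  by move/continuousP: (@lmul_continuous G x^-1%g); apply.
have [D _ CD] : finite_subset_cover [set: G] (fun x => lmul x @` U) C.
  apply: compact_cover_compact cC _ _ _ _ _ => // x _.
  by exists x => //; exists 1%g => //; rewrite /lmul mulg1.
have mxU x : [set` D] x -> measurable (lmul x @` U).
  by move=> _; exact: (open_borel (oxU x)).
apply: le_trans (content_sub_fsum mu (finite_fset D) mxU (compact_borel cC) CD) _.
rewrite fsbig1// => x _; rewrite -U0.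
by have := haar_invariant hmu x (open_borel oU).
Qed.

Lemma haar_compact_nbhs1 (U : set G) : nbhs 1%g U -> 
  exists K : set G, [/\ compact K, (0 < mu K)%E & K `<=` U].
Proof.
rewrite nbhsE => -[V [oV V1] VU]; have := haar_open_gt0 oV V1.
rewrite (haar_inner_regular hmu oV) => /ereal_sup_gt[_ [K [cK KV] <-] K0].
by exists K; split => //; exact: subset_trans VU.
Qed.

(** The sets [D n] of points that lie in [S^n] with their inverses cover [G], so one has positive
    measure and Steinhaus' theorem applies to it. Since [S] may fail to be symmetric, the inverses
    are built into [D n], which puts [D n (D n)^-1] inside [S^(2n)]. *)
Lemma nbhs1_setpow_generates (S : set G) : compact S -> generates S ->
  exists p, nbhs 1%g (setpow S p).
Proof.
move=> cS [S1 SG].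
pose D n := setpow S n `&` (fun x : G => x^-1%g) @^-1` setpow S n.
have cD n : compact (D n).
  apply: compact_closedI; first exact: compact_setpow.
  by apply: compact_closed => //; apply/compact_inv/compact_setpow.
have [n Dn0] : exists n, (0 < mu (D n))%E.
  apply: contrapT => D0; have := haar_neq0 hmu; apply/negP; rewrite negbK.
  apply/eqP/negligibleP => //.
  have -> : [set: borel G] = \bigcup_n D n.
    apply/seteqP; split=> // x _.
    have powS y : exists n, setpow S n y.
      by have : [set: G] y by []; rewrite -SG => -[m _ Sy]; exists m.
    have [[m Sx] [m' SVx]] := (powS x, powS x^-1%g).
    exists (maxn m m') => //; split.
      by apply: setpow_leq Sx => //; exact: leq_maxl.
    by apply: setpow_leq SVx => //; exact: leq_maxr.
  apply: negligible_bigcup => n; apply/negligibleP; first exact: compact_borel.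
  apply/eqP; rewrite -measure_le0 leNgt; apply/negP => Dn0.
  by apply: D0; exists n.
exists (n + n)%N; apply: filterS (steinhaus (cD n) Dn0).
by move=> _ [x [Sx _] [y [_ Sy] <-]]; exact: setpow_mul.
Qed.

End haar_theory.

(** * Real and imaginary parts, and open half-planes of the scalars *)

Section scalars_extra.
Context (R : realType) (k : scalar_kind).
Local Notation K := (scalars R k).
Implicit Types (z w : K) (a b : R).

(** Over the reals [b] is discarded, so the imaginary part of the result is [b] there only when
    [b = 0]. *)
Definition mkK a b : K :=
  match k return scalars R k with
  | RealScalars => a
  | ComplexScalars => (a +i* b)%C
  end.

Lemma reK_mkK a b : reK (mkK a b) = a.
Proof. by rewrite /mkK; case: k. Qed.

Lemma reK_ofR a : reK (ofR k a) = a.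
Proof. by case: k. Qed.

Lemma imK_ofR a : imK (ofR k a) = 0.
Proof. by case: k. Qed.

Lemma reimK_inj z w : reK z = reK w -> imK z = imK w -> z = w.
Proof. by case: k z w => [z w|[a b] [c d]] //= -> ->. Qed.

Lemma ofR_lt a b : (ofR k a < ofR k b) = (a < b).
Proof. by rewrite !lt_neqAle ofR_le (inj_eq (@ofR_inj R k)). Qed.

Lemma reKN z : reK (- z) = - reK z.
Proof. by apply/eqP; rewrite -subr_eq0 opprK -reKD addNr reK0. Qed.

Lemma reKB z w : reK (z - w) = reK z - reK w.
Proof. by rewrite reKD reKN. Qed.

Lemma ofRB a b : ofR k (a - b) = ofR k a - ofR k b.
Proof. by case: k => //=; rewrite rmorphB. Qed.

Lemma modK_ofR a : modK (ofR k a) = `|a|.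
Proof. by rewrite modK_sqrt reK_ofR imK_ofR expr0n addr0 sqrtr_sqr. Qed.

(** The Cauchy-Schwarz inequality in the plane: the difference of the squares of the two sides is
    [(a * imK z - b * reK z) ^+ 2]. *)
Lemma ler_lincomb_modK a b z :
  a * reK z + b * imK z <= Num.sqrt (a ^+ 2 + b ^+ 2) * modK z.
Proof.
rewrite modK_sqrt -sqrtrM ?addr_ge0 ?sqr_ge0//.
apply: le_trans (ler_norm _) _; rewrite -sqrtr_sqr.
rewrite ler_sqrt ?mulr_ge0 ?addr_ge0 ?sqr_ge0//.
rewrite -subr_ge0 (_ : _ - _ = (a * imK z - b * reK z) ^+ 2) ?sqr_ge0//.
by ring.
Qed.

Lemma normr_reK z : `|reK z| <= modK z.
Proof.
by rewrite modK_sqrt -sqrtr_sqr ler_sqrt ?addr_ge0 ?sqr_ge0// lerDl sqr_ge0.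
Qed.

Lemma open_reK_gt a : open [set z : K^o | a < reK z].
Proof.
rewrite openE => z /= az; apply/nbhs_ballP; exists (ofR k (reK z - a)).
  by rewrite /= -(ofR0 R k) ofR_lt subr_gt0.
move=> w; rewrite /ball /= modKE ofR_lt.
move=> /(le_lt_trans (normr_reK _)) /(le_lt_trans (ler_norm _)).
by rewrite reKB ltrD2l ltrN2.
Qed.

Lemma open_reK_lt a : open [set z : K^o | reK z < a].
Proof.
rewrite openE => z /= za; apply/nbhs_ballP; exists (ofR k (a - reK z)).
  by rewrite /= -(ofR0 R k) ofR_lt subr_gt0.
move=> w; rewrite /ball /= distrC modKE ofR_lt.
move=> /(le_lt_trans (normr_reK _)) /(le_lt_trans (ler_norm _)).
by rewrite reKB ltrD2r.
Qed.

End scalars_extra.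

(** * Integration over a set as an element of the dual ball *)

Section integral_functional.
Context (d : measure_display) (T : measurableType d) (R : realType).
Context (mu : {measure set T -> \bar R}) (k : scalar_kind).
Context (A : set T) (mA : measurable A).
Local Notation K := (scalars R k).
Implicit Types (f g : L1fun mu k) (u : L1 mu k).
Local Open Scope quotient_scope.

Let integrable_re f : mu.-integrable A (EFin \o (fun x => reK (f x))).
Proof.
have /asboolP[rf _] := valP f.
exact: (integrableS measurableT mA (@subsetT _ _) rf).
Qed.

Let integrable_im f : mu.-integrable A (EFin \o (fun x => imK (f x))).
Proof.
have /asboolP[_ jf] := valP f.
exact: (integrableS measurableT mA (@subsetT _ _) jf).
Qed.

Let integrableZ (a : R) (h : T -> R) :
  mu.-integrable A (EFin \o h) -> mu.-integrable A (EFin \o (fun x => a * h x)).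
Proof. by move=> ih; exact: (integrableZl mA a ih). Qed.

Let integrableDR (h1 h2 : T -> R) :
  mu.-integrable A (EFin \o h1) -> mu.-integrable A (EFin \o h2) ->
  mu.-integrable A (EFin \o (fun x => h1 x + h2 x)).
Proof. by move=> ih1 ih2; exact: (integrableD mA ih1 ih2). Qed.

Let integrableBR (h1 h2 : T -> R) :
  mu.-integrable A (EFin \o h1) -> mu.-integrable A (EFin \o h2) ->
  mu.-integrable A (EFin \o (fun x => h1 x - h2 x)).
Proof. by move=> ih1 ih2; exact: (integrableB mA ih1 ih2). Qed.

Definition L1fun_integral f : K :=
  mkK k (\int[mu]_(x in A) reK (f x)) (\int[mu]_(x in A) imK (f x)).

Lemma reK_L1fun_integral f : reK (L1fun_integral f) = \int[mu]_(x in A) reK (f x).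
Proof. exact: reK_mkK. Qed.

Lemma imK_L1fun_integral f : imK (L1fun_integral f) = \int[mu]_(x in A) imK (f x).
Proof.
(* In the real case the left side is 0 by definition and the integrand on the right vanishes. *)
rewrite /L1fun_integral; move: f; rewrite /mkK; case: (k) => //= f.
by rewrite /Rintegral integral0_eq.
Qed.

Lemma L1fun_integral_linear (a : K) f g :
  L1fun_integral (a *: f + g) = a * L1fun_integral f + L1fun_integral g.
Proof.
apply: reimK_inj.
  rewrite reKD reKM !reK_L1fun_integral imK_L1fun_integral.
  rewrite -!RintegralZl// -RintegralB ?integrableZ// -RintegralD//; last first.
    by apply: integrableBR; exact: integrableZ.
  by apply: eq_Rintegral => x _; rewrite reKD reKM.
rewrite imKD imKM !imK_L1fun_integral reK_L1fun_integral.
rewrite -!RintegralZl// -RintegralD ?integrableZ// -RintegralD//; last first.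
  by apply: integrableDR; exact: integrableZ.
by apply: eq_Rintegral => x _; rewrite imKD imKM.
Qed.

(* With [L] the integral, [|L|^2 = int (Re L Re f + Im L Im f) <= |L| (int |f|)]. *)
Lemma modK_L1fun_integral f : modK (L1fun_integral f) <= L1fun_norm f.
Proof.
set L := L1fun_integral f.
have [->|L0] := eqVneq (modK L) 0; first exact/Rintegral_ge0/(fun x _ => modK_ge0 _).
have {}L0 : 0 < modK L by rewrite lt0r L0 modK_ge0.
have modf : mu.-integrable A (EFin \o (fun x => modK (f x))).
  exact: (integrableS measurableT mA (@subsetT _ _) (integrable_modK f)).
have LE : modK L * modK L =
    \int[mu]_(x in A) (reK L * reK (f x) + imK L * imK (f x)).
  rewrite RintegralD ?integrableZ// !RintegralZl//.
  rewrite -reK_L1fun_integral -imK_L1fun_integral -!expr2 modK_sqrt.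
  by rewrite sqr_sqrtr ?addr_ge0 ?sqr_ge0.
rewrite -(ler_pM2l L0) LE.
apply: (@le_trans _ _ (\int[mu]_(x in A) (modK L * modK (f x)))).
  apply: le_Rintegral => //; first by apply: integrableDR; exact: integrableZ.
    exact: integrableZ.
  by move=> x _; rewrite [modK L]modK_sqrt ler_lincomb_modK.
rewrite RintegralZl// ler_pM2l// /L1fun_norm /Rintegral fine_le//.
- exact: integrable_fin_num.
- exact: integrable_fin_num (integrable_modK f).
- apply: ge0_subset_integral => //.
    by apply/measurable_EFinP; exact: measurable_modK.
  by move=> x _; rewrite lee_fin modK_ge0.
Qed.

Definition L1_integral u : K^o := L1fun_integral (repr u).

(** Independence of the representative: the two integrals differ by the integral of a null function,
    which the norm bound forces to be 0. *)
Lemma L1_integral_pi f : L1_integral (\pi_(L1 mu k) f) = L1fun_integral f.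
Proof.
apply/eqP; rewrite -subr_eq0; apply/eqP; apply: modK_eq0.
rewrite /L1_integral; set g := repr _.
have -> : L1fun_integral g - L1fun_integral f = L1fun_integral (g - f).
  by rewrite [in RHS]addrC -[- f]scaleN1r L1fun_integral_linear mulN1r addrC.
apply/eqP; rewrite eq_le modK_ge0 andbT (le_trans (modK_L1fun_integral _))//.
rewrite le_eqVlt; apply/orP; left; apply/eqP/L1fun_norm_eq0.
have /L1_eqP : g = f %[mod L1 mu k] by rewrite reprK.
by apply: filterS => x gf; rewrite -[LHS]/(g x - f x) gf subrr.
Qed.

Lemma L1_integral_linear : linear L1_integral.
Proof.
move=> a; elim/quotW => f; elim/quotW => g.
by rewrite -pi_L1Z -pi_L1D !L1_integral_pi L1fun_integral_linear.
Qed.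

HB.instance Definition _ := GRing.isLinear.Build K (L1 mu k) K^o _
  L1_integral L1_integral_linear.

Lemma L1_integral_le u : `|L1_integral u| <= `|u|.
Proof.
elim/quotW: u => f.
by rewrite normr_pi_L1 L1_integral_pi modKE ofR_le modK_L1fun_integral.
Qed.

Definition integral_functional : dual_ball (L1 mu k) :=
  DualBall (dual_fun := L1_integral) L1_integral_le.

Lemma reK_integral_functional f :
  reK (integral_functional (\pi_(L1 mu k) f)) = \int[mu]_(x in A) reK (f x).
Proof. by rewrite /= L1_integral_pi reK_L1fun_integral. Qed.

End integral_functional.

(** * Continuity of evaluations on the dual ball, and open half-spaces *)

Section dual_ball_topology.
Context (K : numFieldType) (V : normedModType K).

Lemma dual_ball_eval_continuous (u : V) :
  continuous (fun l : dual_ball V => l u : K^o).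
Proof.
move=> l; have /cvg_sup/(_ u) lu : l --> l by exact: cvg_id.
move=> A Al; apply: lu.
exact: (@initial_continuous (dual_ball V) K^o (fun l : dual_ball V => l u) l A Al).
Qed.

End dual_ball_topology.

Section slabs.
Context (R : realType) (k : scalar_kind) (V : normedModType (scalars R k)).
Implicit Types (u : V) (a : R).

Lemma open_dual_gt u a : open [set l : dual_ball V | a < reK (l u)].
Proof.
have /continuousP/(_ [set z | a < reK z]) := @dual_ball_eval_continuous _ V u.
by apply; exact: open_reK_gt.
Qed.

Lemma open_dual_lt u a : open [set l : dual_ball V | reK (l u) < a].
Proof.
have /continuousP/(_ [set z | reK z < a]) := @dual_ball_eval_continuous _ V u.
by apply; exact: open_reK_lt.
Qed.

End slabs.

(** * Lower bounds for covering numbers *)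

Section entropy_lower_bound.
Context (R : realType).

Lemma limn_esup_ge (u : nat -> \bar R) (c : \bar R) :
  (forall N, exists2 n, (N <= n)%N & (c <= u n)%E) -> (c <= limn_esup u)%E.
Proof.
move=> cu; rewrite /limn_esup limf_esupE; apply: le_ereal_inf_tmp => _ [A [N _ NA] <-].
have [n Nn cun] := cu N; apply: le_trans cun _; apply: ereal_sup_ubound.
by exists n => //; exact: NA.
Qed.

Lemma log2_ge (m : nat) (x : R) : (2 ^ m)%:R <= x -> m%:R <= log2 x.
Proof.
move=> mx; have ln2 : 0 < ln 2 :> R by rewrite ln_gt0// ltr1n.
have m0 : 0 < (2 ^ m)%:R :> R by rewrite ltr0n expn_gt0.
rewrite /log2 ler_pdivlMr// mulr_natl -lnXn// -natrX ler_ln// posrE//.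
exact: lt_le_trans mx.
Qed.

(** Pigeonhole: choose for each pattern [s] a member of the refining cover that contains [l s]. If
    [s] and [t] share a member, each [g i] sends [l s] and [l t] into a common member of [U], so
    [s = t]. The existence hypothesis keeps the infimum away from its default value 0 on the empty
    set. *)
Lemma cover_number_ge_patterns (G : topologicalGroupType) (X : topologicalType)
    (alpha : G -> X -> X) (S : set G) (U : set (set X)) (m : nat)
    (g : 'I_m -> G) (l : {ffun 'I_m -> bool} -> X) :
  (exists V, finite_open_cover V /\ refines_along alpha S U V) ->
  (forall i, S (g i)) ->
  (forall A i s t, U A -> A (alpha (g i) (l s)) -> A (alpha (g i) (l t)) ->
    s i = t i) ->
  (2 ^ m)%:R <= cover_number R alpha S U.
Proof.
move=> [W [Wcov Wref]] Sg sep; apply: lb_le_inf; first by eexists; exists W.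
move=> _ [V [[fV [_ Vcov]] ref] <-]; rewrite ler_nat.
have /choice[B BP] s : exists B, V B /\ B (l s).
  have [B VB Bl] : (\bigcup_(A in V) A) (l s) by rewrite Vcov.
  by exists B.
have Binj : injective B.
  move=> s t Bst; apply/ffunP => i.
  have [A UA BA] := ref _ _ (Sg i) (BP s).1.
  apply: (sep A) => //; apply: BA; first by exists (l s) => //; exact: (BP s).2.
  by exists (l t) => //; rewrite Bst; exact: (BP t).2.
have -> : (2 ^ m)%N = size [seq B s | s <- enum {ffun 'I_m -> bool}].
  by rewrite size_map -cardE card_ffun card_bool card_ord.
apply: uniq_leq_size; first by rewrite map_inj_uniq// enum_uniq.
by move=> _ /mapP[s _ ->]; rewrite in_fset_set// inE; exact: (BP s).1.
Qed.

End entropy_lower_bound.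

(** * Translates of an indicator and the two-set cover *)

Section normalized_indicator.
Context (G : topologicalGroupType) (R : realType).
Context (mu : {measure set (borel G) -> \bar R}) (hmu : left_haar_measure mu).
Context (hausG : hausdorff_space G).
Context (k : scalar_kind) (C : set G) (cC : compact C) (C0 : (0 < mu C)%E).
Implicit Types (g : G) (A : set (borel G)).
Local Open Scope quotient_scope.

Let c : R := fine (mu C).

Let mC : measurable (C : set (borel G)).
Proof. exact: compact_borel. Qed.

Let muC : mu C = c%:E.
Proof.
by rewrite fineK// ge0_fin_numE ?measure_ge0//; exact: (haar_compact hmu cC).
Qed.

Let c0 : 0 < c.
Proof. by move: C0; rewrite muC lte_fin. Qed.

Let mCg g : measurable (lmul g @^-1` C).
Proof. by rewrite lmul_preimage; exact: measurable_lmul_image. Qed.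

Let muCg g : mu (lmul g @^-1` C) = c%:E.
Proof. by rewrite lmul_preimage -muC; exact: (haar_invariant hmu _ mC). Qed.

Let integrable_indic_finite A : measurable A -> (mu A < +oo)%E ->
  mu.-integrable [set: borel G] (EFin \o \1_A).
Proof.
move=> mA Aoo; apply/integrableP; split; first exact/measurable_EFinP.
rewrite (eq_integral (fun x => (\1_A x)%:E)); last first.
  by move=> x _; rewrite gee0_abs// lee_fin.
by rewrite integral_indic// setIT.
Qed.

Lemma normalized_indicator_L1 :
  (fun x : borel G => ofR k (c^-1 * \1_C x) : (scalars R k)^o) \in L1pred mu k.
Proof.
apply/asboolP; split.
  under eq_fun do rewrite reK_ofR.
  have := integrable_indic_finite mC (haar_compact hmu cC).
  by move=> /(integrableZl measurableT c^-1).
apply: (eq_integrable measurableT (cst 0%E)) => [x _|]; last exact: integrable0.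
by rewrite /= imK_ofR.
Qed.

Definition normalized_indicator : L1fun mu k := MkL1fun normalized_indicator_L1.
Local Notation f0 := normalized_indicator.
Local Notation u0 := (\pi_(L1 mu k) normalized_indicator).

Lemma reK_functional_translate A (mA : measurable A) g :
  reK (integral_functional mu k mA (L1_translate hmu g u0)) =
  c^-1 * fine (mu (lmul g @^-1` C `&` A)).
Proof.
rewrite L1_translate_pi reK_integral_functional.
(* Translation by [g] turns the indicator of [C] into that of [g^-1 C]. *)
transitivity (\int[mu]_(x in A) (c^-1 * \1_(lmul g @^-1` C) x)).
  by apply: eq_Rintegral => x _; rewrite /= reK_ofR.
rewrite RintegralZl//; last first.
  apply: (integrableS measurableT mA (@subsetT _ _)).
  by apply: integrable_indic_finite => //; rewrite muCg ltry.
by rewrite /Rintegral integral_indic.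
Qed.

Lemma functional_translate_sub A (mA : measurable A) g :
  lmul g @^-1` C `<=` A ->
  reK (integral_functional mu k mA (L1_translate hmu g u0)) = 1.
Proof.
move=> CA; rewrite reK_functional_translate setIidl// muCg /= mulVf//.
by rewrite gt_eqF.
Qed.

Lemma functional_translate_disjoint A (mA : measurable A) g :
  lmul g @^-1` C `&` A = set0 ->
  reK (integral_functional mu k mA (L1_translate hmu g u0)) = 0.
Proof. by move=> CA; rewrite reK_functional_translate CA measure0 mulr0. Qed.

Lemma functional_setT : 
  reK (integral_functional mu k measurableT u0) = 1.
Proof.
rewrite reK_integral_functional -(functional_translate_sub measurableT (g := 1%g))//.
rewrite L1_translate_pi reK_integral_functional.
by apply: eq_Rintegral => x _; rewrite /= /lmul mul1g.
Qed.

Let Rintegral_indic A : measurable A -> (\int[mu]_x \1_A x)%R = fine (mu A).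
Proof. by move=> mA; rewrite /Rintegral integral_indic// setIT. Qed.

(** With [x = g h^-1], left invariance reduces the distance to the normalized measure of the
    symmetric difference of [C] and [x^-1 C]. Its two halves have the measures of [x^-1 C \ C] and
    [x C \ C]. *)
Lemma norm_translateB g h :
  `|L1_translate hmu g u0 - L1_translate hmu h u0| =
  ofR k (c^-1 * (fine (mu (lmul (h * g^-1)%g @` C `\` C)) +
                 fine (mu (lmul (g * h^-1)%g @` C `\` C)))).
Proof.
pose B : set (borel G) := C; pose x := (g * h^-1)%g; pose P := lmul x @^-1` C.
have mPC : measurable (P `\` C) by apply: measurableD => //; exact: mCg.
have mCP : measurable (B `\` P) by apply: measurableD => //; exact: mCg.
have -> : mu (lmul (h * g^-1)%g @` C `\` C) = mu (P `\` C).
  by rewrite /P lmul_preimage /x invgF.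
have -> : mu (lmul (g * h^-1)%g @` C `\` C) = mu (B `\` P).
  rewrite -(haar_invariant hmu x mCP); congr (mu _); apply/seteqP; split.
    by move=> _ [[y Cy <-] nC]; exists y.
  by move=> _ [y [Cy nP] <-]; split => //; exists y.
have PCoo : (mu (P `\` C) < +oo)%E.
  by apply: le_lt_trans (ltry c); rewrite -(muCg x) le_measure ?inE.
have CPoo : (mu (B `\` P) < +oo)%E.
  by apply: le_lt_trans (ltry c); rewrite -muC le_measure ?inE.
rewrite !L1_translate_pi.
have -> (f f' : L1fun mu k) :
    \pi_(L1 mu k) f - \pi_(L1 mu k) f' = \pi_(L1 mu k) (f - f').
  by apply/eqP; rewrite subr_eq -pi_L1D subrK.
rewrite normr_pi_L1; congr (ofR k _).
(* [H] is the normalized indicator of the symmetric difference; composing it with [lmul h] gives the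
   integrand, because [g y = x (h y)]. *)
pose H y : R := c^-1 * (\1_(P `\` C) y + \1_(B `\` P) y).
have iPC := integrable_indic_finite mPC PCoo.
have iCP := integrable_indic_finite mCP CPoo.
have HE : (\int[mu]_y H y)%R =
    c^-1 * (fine (mu (P `\` C)) + fine (mu (B `\` P))).
  rewrite RintegralZl//; last exact: (integrableD measurableT iPC iCP).
  by rewrite RintegralD// !Rintegral_indic.
rewrite -HE /Rintegral; congr fine.
rewrite -(haar_integral hmu h (h := EFin \o H)); last first.
- by move=> y; rewrite lee_fin mulr_ge0 ?invr_ge0 ?(ltW c0)// addr_ge0.
- apply/measurable_EFinP; apply: measurable_funM => //.
  by apply: measurable_funD; exact: measurable_indic.
apply: eq_integral => y _ /=; congr EFin.
transitivity (modK (ofR k (c^-1 * (\1_P (lmul h y) - \1_C (lmul h y))))).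
  have gy : lmul g y = lmul x (lmul h y) by rewrite /lmul mulgA mulgVK.
  rewrite mulrBr ofRB -[LHS]/(modK (ofR k (c^-1 * \1_C (lmul g y)) -
    ofR k (c^-1 * \1_C (lmul h y)))).
  by rewrite gy.
rewrite modK_ofR normrM ger0_norm ?invr_ge0 ?(ltW c0)// /H; congr (_ * _).
rewrite !indicE !in_setD.
by case: (_ \in P); case: (_ \in C);
  rewrite /= ?subrr ?subr0 ?sub0r ?normrN ?normr0 ?normr1 ?addr0 ?add0r.
Qed.

(** The distance depends only on [g h^-1], so closeness is uniform over all such pairs. *)
Lemma translate_near (e : R) : 0 < e -> nbhs 1%g
  [set x | forall g h, (g * h^-1)%g = x ->
    `|L1_translate hmu g u0 - L1_translate hmu h u0| < ofR k e].
Proof.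
(* Two terms below [c * e / 2], for [x] and for [x^-1], add up to [e] after division by [c]; a
   symmetric [W] handles both. *)
move=> e0; have ec0 : 0 < c * e / 2 by rewrite divr_gt0// mulr_gt0.
have [W [oW W1 WV WVinv]] := nbhs1_sym_open (haar_translate_small hmu hausG cC ec0).
apply: filterS (open_nbhs_nbhs (conj oW W1)) => x Wx g h gh.
have finW y : W y -> fine (mu (lmul y @` C `\` C)) < c * e / 2.
  move=> /WV /= muy; rewrite -lte_fin fineK// ge0_fin_numE ?measure_ge0//.
  exact: lt_le_trans muy (leey _).
have := finW _ Wx; have := finW _ (WVinv _ Wx).
rewrite -{1}gh invgF norm_translateB gh ofR_lt => lt1 lt2.
by rewrite -ltr_pdivlMl ?invr_gt0// invrK (splitr (c * e)) ltrD.
Qed.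

(** Finitely many right translates [W h] cover [S], and on each of them the distance in norm bounds
    the variation of every [l] in the ball at once. *)
Lemma translate_net (S : set G) (e : R) : compact S -> 0 < e ->
  exists D : {fset G}, forall g, S g -> exists2 h, h \in D &
    forall l : Binfty mu k, `|reK (l (L1_translate hmu g u0)) -
      reK (l (L1_translate hmu h u0))| < e.
Proof.
move=> cS e0; have := translate_near e0.
rewrite nbhsE => -[W [oW W1] WT].
have [D _ SD] : finite_subset_cover [set: G] (fun h => [set g | W (g * h^-1)%g]) S.
  apply: compact_cover_compact cS _ _ _ _ _ => [h _|g _].
    by have /continuousP/(_ W oW) := @mulgr_continuous _ h^-1%g.
  by exists g => //=; rewrite mulgV.
exists D => g /SD[h Dh /WT /= gh]; exists h => // l.
rewrite -reKB -linearB -(ofR_lt k); apply: le_lt_trans (gh g h erefl).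
apply: le_trans (dual_ball_le l _); rewrite modKE ofR_le; exact: normr_reK.
Qed.

(** A functional with real part 1 at the indicator lies only in the first set, one with real part 0
    only in the second; this is what separates patterns. *)
Definition dual_slabs : set (set (Binfty mu k)) :=
  [set [set l : Binfty mu k | 0 < reK (l u0)]; [set l : Binfty mu k | reK (l u0) < 1]].

Lemma dual_slabs_cover : finite_open_cover dual_slabs.
Proof.
split; first exact: finite_set2.
split; first by move=> _ [->|->]; [exact: open_dual_gt|exact: open_dual_lt].
apply/seteqP; split=> // l _; have [l0|l0] := ltP 0 (reK (l u0)).
  by exists [set l : Binfty mu k | 0 < reK (l u0)] => //; left.
exists [set l : Binfty mu k | reK (l u0) < 1]; first by right.
by apply: le_lt_trans l0 _; exact: ltr01.
Qed.

Lemma card_dual_slabs : #|` fset_set dual_slabs| = 2%N.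
Proof.
rewrite fset_setU// !fset_set1 cardfs2.
suff /eqP/negbTE -> : [set l : Binfty mu k | 0 < reK (l u0)] <>
                     [set l : Binfty mu k | reK (l u0) < 1] by [].
(* Integration over all of [G] has value 1 at the indicator, hence lies in the first half-space but
   not in the second. *)
move=> /seteqP[/(_ (integral_functional mu k measurableT))] + _.
by rewrite /mkset functional_setT ltxx => /(_ ltr01).
Qed.

(* Needed because [cover_number] is an infimum in [R], where [inf set0 = 0].  A
   finite L^1 net of the translates of [u0] stands in for the compactness of the
   ball. *)
Lemma dual_slabs_refinement (S : set G) : compact S -> exists V,
  finite_open_cover V /\ refines_along (canonical_action hmu k) S dual_slabs V.
Proof.
(* Any [e < 1/2] makes the slabs [e < r] and [r < 1 - e] cover the line, and an error below [e]
   carries them into [0 < r] and [r < 1]. *)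
move=> cS; pose e : R := 4^-1.
have e0 : 0 < e by rewrite invr_gt0 ltr0n.
have e1 : e < 1 - e by rewrite /e; lra.
have [D DS] := translate_net cS e0.
pose slab (s : {ffun D -> bool}) (h : D) : set (Binfty mu k) :=
  if s h then [set l : Binfty mu k | e < reK (l (L1_translate hmu (val h) u0))]
  else [set l : Binfty mu k | reK (l (L1_translate hmu (val h) u0)) < 1 - e].
exists [set [set l | forall h, slab s h l] | s in [set: {ffun D -> bool}]].
split; last first.
  move=> g _ /DS[h Dh gh] [s _ <-].
  have [sh|sh] := boolP (s [` Dh]%fset).
    exists [set l : Binfty mu k | 0 < reK (l u0)]; first by left.
    move=> _ [l sl <-] /=; have := sl [` Dh]%fset; rewrite /slab sh /= -subr_gt0.
    by have := gh l; rewrite ltr_distl => /andP[+ _] => /[swap]; exact: lt_trans.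
  exists [set l : Binfty mu k | reK (l u0) < 1]; first by right.
  move=> _ [l sl <-] /=; have := sl [` Dh]%fset; rewrite /slab (negbTE sh) /= ltrBrDr.
  by have := gh l; rewrite ltr_distl => /andP[_]; exact: lt_trans.
split; first by apply: finite_image; exact: finite_finset.
split.
  move=> _ [s _ <-]; rewrite openE => l sl.
  apply: (@filter_forall _ _ (slab s) (nbhs l)) => h.
  have : open (slab s h).
    by rewrite /slab; case: ifP => _; [exact: open_dual_gt|exact: open_dual_lt].
  by rewrite openE => /(_ l (sl h)).
apply/seteqP; split=> // l _.
pose s := [ffun h : D => e < reK (l (L1_translate hmu (val h) u0))].
exists [set l | forall h, slab s h l]; first by exists s.
by move=> h; rewrite /slab /s ffunE; case: ltP => //= lh; exact: le_lt_trans e1.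
Qed.

End normalized_indicator.
Arguments dual_slabs {G R mu} hmu hausG k {C} cC.

(** * Exponential growth of covering numbers from separated translates *)

Section pattern_count.
Context (G : topologicalGroupType) (R : realType).
Context (mu : {measure set (borel G) -> \bar R}) (hmu : left_haar_measure mu).
Context (hausG : hausdorff_space G).
Context (k : scalar_kind) (C : set G) (cC : compact C) (C0 : (0 < mu C)%E).

(** The separation hypothesis says that the sets [g_i^-1 C] are pairwise disjoint: a common point
    [z] of two of them would give [g_j g_i^-1 = (g_j z) (g_i z)^-1]. *)
Lemma cover_number_dual_slabs (S : set G) (m : nat) (g : 'I_m -> G) :
  compact S -> (forall i, S (g i)) ->
  (forall i j x y, C x -> C y -> (g j * (g i)^-1)%g = (x * y^-1)%g -> i = j) ->
  (2 ^ m)%:R <= cover_number R (canonical_action hmu k) S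
                  (dual_slabs hmu hausG k cC).
Proof.
move=> cS Sg sep.
have mCg i : measurable (lmul (g i) @^-1` C : set (borel G)).
  by rewrite lmul_preimage; apply: measurable_lmul_image; exact: compact_borel.
pose A (s : {ffun 'I_m -> bool}) : set (borel G) :=
  \bigcup_(i in [set i | s i]) (lmul (g i) @^-1` C).
have mA s : measurable (A s).
  by apply: fin_bigcup_measurable => [|i _]; [exact: finite_finset|exact: mCg].
apply: (@cover_number_ge_patterns _ _ _ _ _ _ _ g
  (fun s => integral_functional mu k (mA s))) => //.
  exact: dual_slabs_refinement.
(* [g_i^-1 C] is contained in [A s] when [s i] holds and disjoint from it otherwise. *)
have value (s : {ffun 'I_m -> bool}) i :
    reK (canonical_action hmu k (g i) (integral_functional mu k (mA s))
      (\pi_(L1 mu k) (normalized_indicator hmu hausG k cC))%qT) = (s i)%:R.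
  rewrite canonical_actionE; case: (boolP (s i)) => si.
    by rewrite functional_translate_sub// => x Cx; exists i.
  rewrite functional_translate_disjoint// -subset0 => x [Cx [j /= sj Cjx]].
  move: si; rewrite (sep i j _ _ Cjx Cx) ?sj//.
  by rewrite /lmul invgM mulgA mulgK.
move=> B i s t [->|->]; rewrite /mkset !value.
  by case: (s i); case: (t i); rewrite ?ltxx.
by case: (s i); case: (t i); rewrite ?ltxx.
Qed.

End pattern_count.

(** * Unbounded entropy over the two-set covers *)

Theorem theorem5p8 (R : realType) (k : scalar_kind) (G : topologicalGroupType)
    (mu : {measure set (borel G) -> \bar R}) (hmu : left_haar_measure mu)
    (S : set G) :
  almost_connected G -> locally_compact [set: G] -> hausdorff_space G ->
  compact S -> generates S -> ~ compact [set: G] ->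
  ereal_sup [set eta R (canonical_action hmu k) S V | V in
    [set V : set (set (Binfty mu k)) |
      finite_open_cover V /\ #|` fset_set V| = 2%N]] = +oo%E.
Proof.
move=> acG _ hausG cS genS ncG; have S1 := genS.1.
have [p0 Sp0] := nbhs1_setpow_generates hmu hausG cS genS.
(* Passing to the successor makes [p] positive for the divisions below; powers of [S] increase
   because [S] contains 1. *)
pose p := p0.+1; have {Sp0} Sp : nbhs 1%g (setpow S p).
  by apply: filterS Sp0; exact: setpow_leq.
have p_gt0 : 0 < p%:R :> R by rewrite ltr0n.
(* It suffices to reach every real [a > 0]; [N] is chosen with [a <= N / p], after [p] has been
   fixed. *)
apply/eqyP => a a0; pose c := Num.truncn (a * p%:R).
pose N := c.+1.
have aN : a <= N%:R / p%:R.
  by rewrite ler_pdivlMr// ltW// truncnS_gt.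
have [V V1 VS] := nbhs1_setpow (2 * N) Sp.
have [W [oW W1 WV WVinv]] := nbhs1_sym_open V1.
have WS j : setpow W (2 * (N * j)) `<=` setpow S (p * j).
  rewrite mulnA -(setpow_setpow W (2 * N)) -(setpow_setpow S); apply: setpow_subset.
  by apply: subset_trans VS; exact: setpow_subset.
(* As [n <= 2 * (N * n)], the power [W^n] lies in the compact set [S^(p n)]. *)
have WC n : exists2 C, compact C & setpow W n `<=` C.
  exists (setpow S (p * n)); first exact: compact_setpow.
  apply: subset_trans (WS n); apply: setpow_leq => //.
  by rewrite mulnA leq_pmull.
have [g Wg gW] := setpow_separated acG ncG oW W1 WVinv WC.
(* With [U U] inside [W] and [U'] symmetric inside [U], a set [C] inside [U'] has [C C^-1] inside
   [W]. *)
have [U U1 UW] := nbhs1_mul (open_nbhs_nbhs (conj oW W1)).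
have [U' [oU' U'1 U'U U'V]] := nbhs1_sym_open U1.
have [C [cC C0 CU']] := haar_compact_nbhs1 hmu hausG (open_nbhs_nbhs (conj oU' U'1)).
apply: le_ereal_sup_tmp.
exists (eta R (canonical_action hmu k) S (dual_slabs hmu hausG k cC)).
  exists (dual_slabs hmu hausG k cC) => //; split.
    exact: dual_slabs_cover.
  exact: card_dual_slabs.
(* Only the multiples of [p] are used; [M.+1] keeps the index nonzero and at least [M]. *)
apply: limn_esup_ge => M; exists (p * M.+1)%N.
  by rewrite (leq_trans (leqnSn M))// leq_pmull.
have : (2 ^ (N * M.+1))%:R <= cover_number R (canonical_action hmu k)
    (setpow S (p * M.+1)) (dual_slabs hmu hausG k cC).
  apply: (@cover_number_dual_slabs _ _ mu hmu hausG k C cC C0 _ _ (fun i => g i)).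
  - exact: compact_setpow.
  (* Since [i < N * M.+1], the exponent [2i + 2] is at most [2 * (N * M.+1)]. *)
  - move=> i; apply: WS; apply: setpow_leq (Wg i) => //.
    by rewrite -doubleS -mul2n leq_pmul2l.
  - move=> i j x y Cx Cy gij; apply: contrapT => /eqP ij.
    apply: (gW i j) => //; rewrite gij; apply: UW; first exact/U'U/CU'.
    exact/U'U/U'V/CU'.
(* The logarithm is at least [N * M.+1]; dividing by [p * M.+1] leaves [N / p]. *)
move=> /log2_ge le2; rewrite lee_fin (le_trans aN)//.
rewrite ler_pdivlMr ?ltr0n ?muln_gt0// (le_trans _ le2)//.
by rewrite !natrM mulrA divfK// gt_eqF.
Qed.
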